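(* Let $1<p<\infty$, $p'=p/(p-1)$, $p^*=\max\{p,p'\}$ and $p^{\#}=\min\{p,p'\}$. Then the disjoint-democracy constant of the Haar system $\mathcal{H}^{(p)}$ in $L_p=L_p[0,1]$ satisfies \[ \Delta_d[\mathcal{H}^{(p)},L_p]\ge \frac{2^{1/p^{\#}}-1}{2^{1/p^*}-1}. \]
   Context: Scalars are $\mathbb{F}=\mathbb{R}$ or $\mathbb{C}$. Haar system. Let $\mathcal{D}$ be the collection of all dyadic intervals $I=[a,b)$ contained in $[0,1)$, and let $\mathcal{D}_0=\mathcal{D}\cup\{0\}$. The Haar system is $\mathcal{H}^{(p)}=(h_I^{(p)})_{I\in\mathcal{D}_0}$, where $h_0^{(p)}$ is the constant function $1$ on $[0,1)$ and, for $I=[a,b)\in\mathcal{D}$, $h_I^{(p)}$ is supported on $I$, equals $-(b-a)^{-1/p}$ on $[a,(a+b)/2)$ and equals $(b-a)^{-1/p}$ on $[(a+b)/2,b)$. For a basis $\mathcal{B}=(\mathbf{x}_j)_{j\in J}$ of a Banach space $\mathbb{X}$, the disjoint-democracy constant $\Delta_d[\mathcal{B},\mathbb{X}]$ is the smallest constant $C\in[1,\infty]$ such that $\|\sum_{j\in A}\mathbf{x}_j\|\le C\|\sum_{j\in B}\mathbf{x}_j\|$ for all finite $A,B\subseteq J$ with $|A|=|B|$ and $A\cap B=\emptyset$. *)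

(* Defs.v *)
From HB Require Import structures.
From mathcomp Require Import all_boot all_order all_algebra finmap.
From mathcomp Require Import all_classical all_reals all_analysis.
From mathcomp Require Import complex.
Set Implicit Arguments.
Unset Strict Implicit.
Unset Printing Implicit Defensive.
Import Order.TTheory GRing.Theory Num.Theory.
Import numFieldNormedType.Exports.
Local Open Scope classical_set_scope.
Local Open Scope ring_scope.

Variant scalars := RealScalars | ComplexScalars.

(* [Rcomplex R] is [R[i]] with its R-valued modulus as norm; the norm of
   [R[i]] itself takes values in [R[i]]. *)
Definition scalar_type (R : realType) (F : scalars) : normedZmodType R :=
  match F with
  | RealScalars => R
  | ComplexScalars => Rcomplex R
  end.

Definition scalar_of_real (R : realType) (F : scalars) :
    R -> scalar_type R F :=
  match F return R -> scalar_type R F with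
  | RealScalars => fun t => t
  | ComplexScalars => fun t => (real_complex R t : Rcomplex R)
  end.

(* [N] is the norm of the space. For a basis, [C = +oo] is always admissible:
   the right-hand side +oo * 0 = 0 only occurs when both A and B are empty. *)
Definition disjoint_democracy_constant (R : realType) (V : zmodType)
    (N : V -> \bar R) (J : choiceType) (x : J -> V) : \bar R :=
  ereal_inf [set C : \bar R | (1 <= C)%E /\
    forall A B : {fset J}, #|` A| = #|` B| -> [disjoint A & B]%fset ->
      (N (\sum_(j <- A) x j)%R <= C * N (\sum_(j <- B) x j)%R)%E].

Definition lebesgue01 (R : realType) :
    {measure set measurableTypeR R -> \bar R} :=
  mrestr (@lebesgue_measure R) (measurable_itv `[0%R, 1%R]).

(* Elements of L_p[0,1] are given by representatives defined on all of [R];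
   values outside [0,1] do not matter for [lebesgue01]. *)
Definition Lp_norm (R : realType) (K : normedZmodType R) (p : R)
    (f : R -> K) : \bar R :=
  Lnorm (@lebesgue01 R) p%:E (fun x => `|f x|%:E).

(* [Tagged _ k] with [k : 'I_(2 ^ n)] is the interval [k/2^n, (k+1)/2^n). *)
Definition dyadic : choiceType := {n : nat & 'I_(2 ^ n)}.

Definition dyadic_left (R : realType) (D : dyadic) : R :=
  (tagged D : nat)%:R / 2 ^+ tag D.

Definition dyadic_right (R : realType) (D : dyadic) : R :=
  (tagged D : nat).+1%:R / 2 ^+ tag D.

(* [None] is the extra index 0 of the constant function. *)
Definition real_haar (R : realType) (p : R) (j : option dyadic) (x : R) : R :=
  match j with
  | None => if x \in `[0, 1[ then 1 else 0
  | Some D =>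
      let a := dyadic_left R D in
      let b := dyadic_right R D in
      let m := (a + b) / 2 in
      if x \in `[a, m[ then - (b - a) `^ (- p^-1)
      else if x \in `[m, b[ then (b - a) `^ (- p^-1)
      else 0
  end.

Definition haar (R : realType) (F : scalars) (p : R) (j : option dyadic) :
    R -> scalar_type R F :=
  fun x => scalar_of_real F (real_haar p j x).

(* Main.v *)
Require Import Defs.
From HB Require Import structures.
From mathcomp Require Import all_boot all_order all_algebra finmap.
From mathcomp Require Import all_classical all_reals all_analysis.
From mathcomp Require Import complex.
From mathcomp Require Import measurable_realfun lra ring.
Set Implicit Arguments.
Unset Strict Implicit.
Unset Printing Implicit Defensive.
Import Order.TTheory GRing.Theory Num.Theory.
Local Open Scope ring_scope.

(** Put [t = 2 ^ (1 / p)], so that [1 < t < 2], and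
    [c = (2 - t) / (t * (t - 1))].  Two families of [N] Haar functions are
    compared.

    The row consists of [N] Haar functions of the same level.  Their supports
    are disjoint, so their sum has norm [N ^ (1 / p)] ([Lp_norm_row]).

    The chain consists of the Haar functions of [[0, 2 ^ -n)] for [n < N].  On
    [[2 ^ -(k+1), 2 ^ -k)] their sum is [- c * t * t ^ k] plus a constant
    ([chain_sumE]).  Since [(t ^ k) ^ p] times the length of this interval is
    [1 / 2], the leading part has norm [c * t * (N / 2) ^ (1 / p)], that is
    [c * N ^ (1 / p)], while the remainder is bounded independently of [N]
    ([chain_sum_near_staircase]).

    The two families are disjoint, so an admissible constant [C] bounds the norm
    of either sum by [C] times the norm of the other.  Letting [N] tend to
    infinity ([unbounded_powR_absorbs]) gives both [C >= c] and [C >= 1 / c].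
    Finally [2 ^ (1 / p')] equals [2 / t], hence
    [c = (2 ^ (1 / p') - 1) / (2 ^ (1 / p) - 1)]: the claimed bound is [c] or
    [1 / c], according to which of [p] and [p'] is larger. *)

(** * The norm of step functions on the unit interval *)

Definition chi (R : realType) (u v : R) : R -> R := \1_(`[u, v[%classic).

Lemma chiE (R : realType) (u v x : R) : chi u v x = (u <= x < v)%R%:R.
Proof.
rewrite /chi indicE; congr (_%:R); congr nat_of_bool.
by rewrite mem_setE in_itv.
Qed.

Lemma measurable_chi (R : realType) (u v : R) :
  measurable_fun [set: measurableTypeR R] (chi u v).
Proof. exact: measurable_indic. Qed.

Lemma measurable_scaled_chi (R : realType) (a u v : R) :
  measurable_fun [set: measurableTypeR R] (fun x => a * chi u v x).
Proof. by apply: measurable_funM => //; exact: measurable_chi. Qed.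

Lemma chi_split (R : realType) (u m v x : R) : u <= m -> m <= v ->
  chi u v x = chi u m x + chi m v x.
Proof.
move=> um mv; rewrite !chiE.
case: (leP u x) => h1; case: (ltP x v) => h2; case: (leP m x) => h3 /=;
  rewrite ?addr0 ?add0r //.
all: by exfalso; lra.
Qed.

Lemma chi_disjoint (R : realType) (u v u' v' x : R) : v <= u' ->
  chi u v x = 0 \/ chi u' v' x = 0.
Proof.
rewrite !chiE => vu; case: (ltP x v) => xv; last by rewrite andbF; left.
by right; rewrite [u' <= x]leNgt (lt_le_trans xv vu).
Qed.

Lemma lebesgue01_itv (R : realType) (u v : R) : 0 <= u -> u <= v -> v <= 1 ->
  @lebesgue01 R `[u, v[%classic = (v - u)%:E.
Proof.
move=> u0 uv v1; rewrite /lebesgue01 /= /mrestr.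
rewrite (_ : setI _ _ = `[u, v[%classic); last first.
  apply/seteqP; split=> [x []//|x /= xuv]; split => //.
  by move: xuv; rewrite /= !in_itv /=; lra.
rewrite lebesgue_measure_itv /= lte_fin.
case: ltP => [_|vu]; first by rewrite EFinB.
by rewrite (_ : v - u = 0) //; lra.
Qed.

(** The integral of a combination of interval indicators is linear in them, so
    the intervals may overlap.  The assumption is on [|f| ^ p] rather than on
    [f] because a sum of Haar functions of one level changes sign inside each
    dyadic interval, while the [p]-th power of its modulus does not. *)
Lemma Lp_norm_step (R : realType) (K : normedZmodType R) (p : R) (f : R -> K)
    (N : nat) (a u v : 'I_N -> R) :
  (forall i, 0 <= a i) -> (forall i, [/\ 0 <= u i, u i <= v i & v i <= 1]) ->
  (forall x, `|f x| `^ p = \sum_(i < N) a i * chi (u i) (v i) x) ->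
  Lp_norm p f = ((\sum_(i < N) a i * (v i - u i)) `^ p^-1)%:E.
Proof.
move=> a0 uv fE; rewrite /Lp_norm unlock -poweR_EFin; congr (_ `^ _)%E.
under eq_integral => x _ do rewrite /= normr_id fE -sumEFin.
rewrite ge0_integral_sum //=; first last.
- by move=> i x _; rewrite lee_fin mulr_ge0 // chiE.
- move=> i; apply/measurable_EFinP; apply: measurable_funM => //.
  exact: measurable_chi.
rewrite -sumEFin; apply: eq_bigr => i _.
have [u0 uiv v1] := uv i.
under eq_integral => x _ do rewrite EFinM.
rewrite ge0_integralZl_EFin //; first last.
- by apply/measurable_EFinP; exact: measurable_chi.
- by move=> x _; rewrite lee_fin chiE.
rewrite EFinM -lebesgue01_itv // /chi.
by rewrite integral_indic // setIT.
Qed.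

Lemma Lp_norm_scaled_chi (R : realType) (p c u v : R) : 0 < p ->
  0 <= u -> u <= v -> v <= 1 ->
  Lp_norm p (fun x => c * chi u v x) = (`|c| * (v - u) `^ p^-1)%:E.
Proof.
move=> p0 u0 uv v1.
rewrite (@Lp_norm_step R R p _ 1 (fun=> `|c| `^ p) (fun=> u) (fun=> v)).
- rewrite big_ord1 powRM ?powR_ge0 ?subr_ge0 // -powRrM mulfV ?gt_eqF //.
  by rewrite powRr1.
- by move=> _; exact: powR_ge0.
- by [].
move=> x; rewrite big_ord1 chiE; case: (_ && _) => /=.
  by rewrite !mulr1.
by rewrite !mulr0 normr0 powR0 // gt_eqF.
Qed.

Lemma Lp_norm_triangle (R : realType) (p : R) (f g : R -> R) : 1 <= p ->
  measurable_fun [set: measurableTypeR R] f ->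
  measurable_fun [set: measurableTypeR R] g ->
  (Lp_norm p (fun x => f x + g x)%R <= Lp_norm p f + Lp_norm p g)%E.
Proof.
move=> p1 mf mg.
have LE (h : R -> R) : Lp_norm p h = Lnorm (@lebesgue01 R) p%:E (EFin \o h).
  exact: (Lnorm_abse (@lebesgue01 R) (EFin \o h) p%:E).
rewrite !LE; exact: minkowski_EFin.
Qed.

Lemma Lp_normZ (R : realType) (p a : R) (f : R -> R) : 0 < p ->
  measurable_fun [set: measurableTypeR R] f ->
  Lp_norm p (fun x => a * f x) = (`|a|%:E * Lp_norm p f)%E.
Proof.
move=> p0 mf; rewrite /Lp_norm unlock.
under eq_integral => x _ do
  rewrite /= normr_id normrM powRM // EFinM.
rewrite ge0_integralZl_EFin //; last first.
  apply/measurable_EFinP.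
  apply: (@measurableT_comp _ _ _ _ _ _ (@powR R ^~ p)) => //.
  exact: measurableT_comp.
under [in RHS]eq_integral => x _ do rewrite /= normr_id.
rewrite poweRM ?lee_fin ?powR_ge0 ?integral_ge0 //.
by rewrite poweR_EFin -powRrM mulfV ?gt_eqF // powRr1.
Qed.

(** At a fixed point, functions with disjoint supports have at most one
    nonzero value, so the [p]-th power of the modulus is additive on them. *)
Lemma normr_powR_sum_disjoint (R : realType) (p : R) (N : nat) (f : 'I_N -> R) :
  p != 0 -> (forall i j, i != j -> f i = 0 \/ f j = 0) ->
  `|\sum_i f i| `^ p = \sum_i `|f i| `^ p.
Proof.
move=> p0 disj; have [f0|/existsNP[i /eqP fi]] := pselect (forall i, f i = 0).
  by rewrite !big1 ?normr0 ?powR0 // => i _; rewrite f0 normr0 powR0.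
have f0 j : j != i -> f j = 0.
  by move=> /disj[//|fi0]; rewrite fi0 eqxx in fi.
rewrite (bigD1 i) //= (bigD1 (F := fun k => `|f k| `^ p) i) //=.
rewrite !big1 ?addr0 // => j /f0 ->; by rewrite normr0 powR0.
Qed.

(** * Powers *)

Lemma ltr1_powR2 (R : realType) (s : R) : 0 < s -> 1 < 2 `^ s.
Proof.
move=> s0; have := @gt0_ltr_powR R s s0 1 2; rewrite powR1; apply.
- by rewrite nnegrE.
- by rewrite nnegrE.
- by rewrite ltr1n.
Qed.

Lemma powR2_inv_lt2 (R : realType) (p : R) : 1 < p -> 2 `^ p^-1 < 2.
Proof.
move=> p1; have q0 : 0 < 1 - p^-1 by rewrite subr_gt0 invf_lt1 //; lra.
have E : 2 `^ p^-1 * 2 `^ (1 - p^-1) = 2 :> R.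
  by rewrite -powRD ?pnatr_eq0 ?implybT // subrKC powRr1.
by rewrite -[ltRHS]E ltr_pMr ?powR_gt0 // ltr1_powR2.
Qed.

(** Dividing by [N ^ s] and letting [N] tend to infinity makes the
    constant error [K] disappear; this is what turns norm estimates that are exact only
    up to a constant into a sharp comparison of the leading factors. *)
Lemma unbounded_powR_absorbs (R : realType) (s a b K : R) : 0 < s ->
  (forall N : nat, (0 < N)%N -> a * N%:R `^ s <= b * N%:R `^ s + K) -> a <= b.
Proof.
move=> s0 H; rewrite leNgt; apply/negP => ba.
pose M := Num.max 0 (K / (a - b)).
have M0 : 0 <= M by rewrite le_max lexx.
pose N := (Num.truncn (M `^ s^-1)).+1.
have NM : M < N%:R `^ s.
  have -> : M = (M `^ s^-1) `^ s.
    by rewrite -powRrM mulVf ?gt_eqF // powRr1.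
  by rewrite gt0_ltr_powR ?nnegrE ?powR_ge0 // truncnS_gt.
have := H N isT.
have : K < (a - b) * N%:R `^ s.
  rewrite mulrC -ltr_pdivrMr ?subr_gt0 //.
  by apply: le_lt_trans NM; rewrite le_max lexx orbT.
rewrite mulrBl; lra.
Qed.

(** * Haar functions *)

Lemma dyadic_length (R : realType) (D : dyadic) :
  dyadic_right R D - dyadic_left R D = (2 ^+ tag D)^-1.
Proof.
by rewrite /dyadic_right /dyadic_left -mulrBl -natrB // subSnn mul1r.
Qed.

Lemma dyadic_lt (R : realType) (D : dyadic) :
  dyadic_left R D < dyadic_right R D.
Proof. by rewrite -subr_gt0 dyadic_length invr_gt0 exprn_gt0. Qed.

(** The height of a Haar function at level [n] is the [n]-th power of
    [t = 2 ^ (1 / p)], so the partial sums along the chain are geometric in [t]. *)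
Lemma haar_height (R : realType) (p : R) (n : nat) :
  ((2 ^+ n)^-1 : R) `^ (- p^-1) = (2 `^ p^-1) ^+ n.
Proof.
by rewrite -powR_invn // -powRrM mulrNN mulrC powRrM powR_mulrn //.
Qed.

Lemma haar_height_powR (R : realType) (p : R) (n : nat) : 0 < p ->
  ((2 `^ p^-1) ^+ n) `^ p = 2 ^+ n :> R.
Proof.
move=> p0; rewrite -powR_mulrn ?powR_ge0 // powRAC -[X in X `^ _]powRrM.
by rewrite mulVf ?gt_eqF // powRr1 // powR_mulrn.
Qed.

Lemma real_haarE (R : realType) (p : R) (D : dyadic) (x : R) :
  let a := dyadic_left R D in let b := dyadic_right R D in
  let m := (a + b) / 2 in
  real_haar p (Some D) x =
    (2 `^ p^-1) ^+ tag D * (chi m b x - chi a m x).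
Proof.
have ab := dyadic_lt R D.
rewrite /= dyadic_length haar_height !chiE !in_itv /=.
set a := dyadic_left R D in ab *; set b := dyadic_right R D in ab *.
case: (leP a x) => h1; case: (ltP x b) => h2;
  case: (leP ((a + b) / 2) x) => h3 /=;
 rewrite ?subr0 ?sub0r ?mulr1 ?mulrN1 ?mulr0 //.
all: by exfalso; lra.
Qed.

Lemma measurable_real_haar (R : realType) (p : R) (D : dyadic) :
  measurable_fun [set: measurableTypeR R] (real_haar p (Some D) : R -> R).
Proof.
rewrite (_ : real_haar p (Some D) = fun x => (2 `^ p^-1) ^+ tag D *
    (chi ((dyadic_left R D + dyadic_right R D) / 2) (dyadic_right R D) x -
     chi (dyadic_left R D) ((dyadic_left R D + dyadic_right R D) / 2) x)).
  apply: measurable_funM => //.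
  by apply: measurable_funB; exact: measurable_chi.
by apply/funext => x; rewrite real_haarE.
Qed.

Lemma normr_powR_haar (R : realType) (p : R) (D : dyadic) (x : R) : 0 < p ->
  `|real_haar p (Some D) x| `^ p =
  2 ^+ tag D * chi (dyadic_left R D) (dyadic_right R D) x.
Proof.
move=> p0; have ab := dyadic_lt R D.
rewrite real_haarE.
rewrite (@chi_split _ _ ((dyadic_left R D + dyadic_right R D) / 2)); [|lra|lra].
have T0 : 0 <= (2 `^ p^-1) ^+ tag D :> R by rewrite exprn_ge0 // powR_ge0.
rewrite !chiE normrM (ger0_norm T0) powRM // haar_height_powR //; congr (_ * _).
have z : 0 `^ p = 0 :> R by rewrite powR0 // gt_eqF.
set a := dyadic_left R D in ab *; set b := dyadic_right R D in ab *.
case: (leP a x) => h1; case: (ltP x b) => h2;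
  case: (leP ((a + b) / 2) x) => h3 /=;
  rewrite ?addr0 ?add0r ?subr0 ?sub0r ?normrN ?normr1 ?normr0 ?powR1 ?z //.
all: by exfalso; lra.
Qed.

Lemma real_haar_eq0 (R : realType) (p : R) (D : dyadic) (x : R) : 0 < p ->
  chi (dyadic_left R D) (dyadic_right R D) x = 0 -> real_haar p (Some D) x = 0.
Proof.
move=> p0 x0; have := normr_powR_haar D x p0; rewrite x0 mulr0.
by move/powR_eq0_eq0/normr0_eq0.
Qed.

(** The Haar functions and the coefficients are real, and the modulus of a
    real number does not depend on the scalar field, so the complex case is the
    real one. *)
Lemma Lp_norm_haar_sum (R : realType) (F : scalars) (p : R)
    (A : {fset option dyadic}) :
  Lp_norm p (\sum_(j <- A) @haar R F p j) =
  Lp_norm p (\sum_(j <- A) real_haar p j).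
Proof.
rewrite /Lp_norm; apply: eq_Lnorm => x; congr (_%:E).
rewrite !fct_sumE.
suff -> : \sum_(j <- A) @haar R F p j x =
          scalar_of_real F (\sum_(j <- A) real_haar p j x).
  case: F => //=.
  by rewrite /Num.norm /= /Normc.normc expr0n /= addr0 sqrtr_sqr.
case: F; first by [].
rewrite /haar /=.
exact/esym/(big_morph (real_complex R) (rmorphD _) (rmorph0 _)).
Qed.

(** * Two disjoint index sets of the same cardinality *)

(** The nested dyadic intervals [[0, 2 ^ -i)]: shrinking always to the left
    half puts every later Haar function where all earlier ones are negative,
    opposite in sign to its own value on its right half. *)
Definition chain_index (N : nat) (i : 'I_N) : option dyadic :=
  Some (Tagged (fun n => 'I_(2 ^ n)) (Ordinal (expn_gt0 2 i : (0 < 2 ^ i)%N))).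

(** The first [N] dyadic intervals of level [N].  The level [N] is taken as
    large as the number of intervals: it provides [2 ^ N >= N] of them, and
    it differs from the levels [0, ..., N - 1] occurring in the chain. *)
Definition row_index (N : nat) (i : 'I_N) : option dyadic :=
  Some (Tagged (fun n => 'I_(2 ^ n))
    (widen_ord (ltnW (ltn_expl N (isT : (1 < 2)%N))) i)).

Definition index_range (N : nat) (f : 'I_N -> option dyadic) :
  {fset option dyadic} :=
  [fset f i | i in 'I_N]%fset.

Lemma chain_index_inj N : injective (@chain_index N).
Proof.
move=> i j /(congr1 (fun o => if o is Some D then tag D else 0%N)) /= ij.
exact: val_inj.
Qed.

Lemma row_index_inj N : injective (@row_index N).
Proof.
pose pos (o : option dyadic) :=
  if o is Some D then val (tagged D : 'I_(2 ^ tag D)) else 0%N.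
move=> i j /(congr1 pos) /= ij.
exact: val_inj.
Qed.

Lemma big_index_range (V : zmodType) N (f : 'I_N -> option dyadic)
    (G : option dyadic -> V) :
  injective f -> \sum_(j <- index_range f) G j = \sum_(i < N) G (f i).
Proof.
move=> fi; rewrite big_imfset /=; last by move=> i j _ _; exact: fi.
by rewrite big_enum.
Qed.

Lemma card_index_range N (f : 'I_N -> option dyadic) :
  injective f -> #|` index_range f| = N.
Proof.
by move=> fi; rewrite card_imfset //= -cardE card_ord.
Qed.

Lemma chain_row_disjoint N :
  [disjoint index_range (@chain_index N) & index_range (@row_index N)]%fset.
Proof.
apply/fdisjointP => j /imfsetP[i _ ->]; apply/negP => /imfsetP[k _].
move/(congr1 (fun o => if o is Some D then tag D else 0%N)) => /= iN.
by have := ltn_ord i; rewrite iN ltnn.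
Qed.

(** * Norms of the row and of the chain *)

(** Disjoint normalised functions: the [p]-th powers of the norms add up. *)
Lemma Lp_norm_row (R : realType) (F : scalars) (p : R) (N : nat) : 0 < p ->
  Lp_norm p (\sum_(j <- index_range (@row_index N)) @haar R F p j) =
  (N%:R `^ p^-1)%:E.
Proof.
move=> p0; rewrite Lp_norm_haar_sum (big_index_range _ (@row_index_inj N)).
have E (i : 'I_N) : (i.+1%:R / 2 ^+ N) - (i%:R / 2 ^+ N) = (2 ^+ N)^-1 :> R.
  by rewrite -mulrBl -natrB // subSnn mul1r.
have pos : 0 < (2 ^+ N)^-1 :> R by rewrite invr_gt0 exprn_gt0.
rewrite (@Lp_norm_step R R p _ N (fun=> 2 ^+ N) (fun i => i%:R / 2 ^+ N)
  (fun i => i.+1%:R / 2 ^+ N)).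
- rewrite (eq_bigr (fun=> 1)); last first.
    by move=> i _; rewrite E mulfV // expf_neq0.
  by rewrite sumr_const card_ord.
- by move=> i; rewrite exprn_ge0.
- move=> i; split; first by rewrite divr_ge0 // exprn_ge0.
    by rewrite -subr_ge0 E ltW.
  rewrite ler_pdivrMr ?exprn_gt0 // mul1r -natrX ler_nat.
  exact: leq_trans (ltn_ord i) (ltnW (ltn_expl N (isT : (1 < 2)%N))).
move=> x; rewrite fct_sumE normr_powR_sum_disjoint ?gt_eqF //; last first.
  suff H (i j : 'I_N) : (i < j)%N ->
     real_haar p (row_index i) x = 0 \/ real_haar p (row_index j) x = 0.
    move=> i j; rewrite neq_ltn => /orP[] /H [] ->; by [left|right].
  move=> ij; have : i.+1%:R / 2 ^+ N <= j%:R / 2 ^+ N :> R.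
    by rewrite ler_pM2r // ler_nat.
  by move=> /(@chi_disjoint _ (i%:R / 2 ^+ N) _ _ (j.+1%:R / 2 ^+ N) x)[] h;
    [left|right]; apply: real_haar_eq0.
apply: eq_bigr => i _; exact: normr_powR_haar.
Qed.

(** With [t = 2 ^ (1 / p)] every step of this function contributes exactly
    [1 / 2] to the integral of its [p]-th power. *)
Definition staircase (R : realType) (t : R) (N : nat) (x : R) : R :=
  \sum_(k < N) t ^+ k * chi (2 ^+ k.+1)^-1 (2 ^+ k)^-1 x.

Lemma measurable_staircase (R : realType) (t : R) (N : nat) :
  measurable_fun [set: measurableTypeR R] (staircase t N).
Proof.
apply: measurable_sum => i; apply: measurable_funM => //; exact: measurable_chi.
Qed.

Lemma Lp_norm_staircase (R : realType) (p : R) (N : nat) : 0 < p ->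
  Lp_norm p (staircase (2 `^ p^-1) N) = (N%:R `^ p^-1 / 2 `^ p^-1)%:E.
Proof.
move=> p0.
have half k : (2 ^+ k.+1)^-1 = (2 ^+ k)^-1 / 2 :> R by rewrite exprSr invfM.
have pos k : 0 < (2 ^+ k)^-1 :> R by rewrite invr_gt0 exprn_gt0.
rewrite (@Lp_norm_step R R p _ N (fun k => 2 ^+ k) (fun k => (2 ^+ k.+1)^-1)
  (fun k => (2 ^+ k)^-1)).
- rewrite (eq_bigr (fun=> 2^-1)); last first.
    move=> i _; rewrite half; field; by rewrite expf_neq0.
  rewrite sumr_const card_ord -[_ *+ N]mulr_natl.
  rewrite (@powRM R N%:R) // ?invr_ge0 //.
  congr (_ * _)%:E; apply: (mulIf (lt0r_neq0 (powR_gt0 p^-1 (ltr0n R 2)))).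
  by rewrite -powRM // mulVf // mulVf ?powR1 // gt_eqF // powR_gt0.
- by move=> i; rewrite exprn_ge0.
- move=> i; have := pos i; rewrite half => h; split; [lra|lra|].
  by rewrite invf_le1 ?exprn_gt0 // exprn_ege1 //; lra.
move=> x; rewrite /staircase normr_powR_sum_disjoint ?gt_eqF //; last first.
  suff H (i j : 'I_N) : (i < j)%N ->
     chi (2 ^+ i.+1)^-1 (2 ^+ i)^-1 x = 0 \/
     chi (2 ^+ j.+1)^-1 (2 ^+ j)^-1 x = 0 :> R.
    move=> i j; rewrite neq_ltn => /orP[] /H [] ->; rewrite !mulr0;
      by [left|right].
  move=> ij; have : (2 ^+ j)^-1 <= (2 ^+ i.+1)^-1 :> R.
    by rewrite lef_pV2 ?posrE ?exprn_gt0 // ler_eXn2l //; lra.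
  by move=> /(@chi_disjoint _ (2 ^+ j.+1)^-1 _ _ (2 ^+ i)^-1 x)[]; [right|left].
apply: eq_bigr => i _; rewrite chiE; case: (_ && _) => /=.
  rewrite !mulr1 ger0_norm ?exprn_ge0 ?powR_ge0 //.
  exact: haar_height_powR.
by rewrite !mulr0 normr0 powR0 // gt_eqF.
Qed.

(** On [[2 ^ -(k+1), 2 ^ -k)] the Haar functions of the longer intervals of
    the chain take the values [- t ^ n] with [n < k], a geometric sum, against
    the single value [t ^ k] of [[0, 2 ^ -k)]; this gives
    [t ^ k - (t ^ k - 1) / (t - 1) = 1 / (t - 1) - (2 - t) / (t - 1) * t ^ k].
    The constant [1 / (t - 1)] is kept on all of [[0, 1)], and the second
    indicator corrects it on [[0, 2 ^ -N)], the interval not yet divided. *)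
Lemma chain_sumE (R : realType) (p : R) (N : nat) (x : R) : 0 < p ->
  let t := 2 `^ p^-1 in
  \sum_(i < N) real_haar p (chain_index i) x =
  (t - 1)^-1 * chi 0 1 x + - ((t - 1)^-1 * t ^+ N) * chi 0 (2 ^+ N)^-1 x
  + - ((2 - t) / (t - 1)) * staircase t N x.
Proof.
move=> p0 t; have t1 : 1 < t by rewrite ltr1_powR2 // invr_gt0.
rewrite /staircase; elim: N => [|N IH].
  by rewrite !big_ord0 !expr0 invr1; ring.
have E : real_haar p (chain_index (@ord_max N)) x =
    t ^+ N * (chi (2 ^+ N.+1)^-1 (2 ^+ N)^-1 x - chi 0 (2 ^+ N.+1)^-1 x).
  rewrite /chain_index real_haarE /dyadic_left /dyadic_right /=.
  rewrite mul0r add0r mul1r.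
  by rewrite exprSr invfM.
rewrite !big_ord_recr E.
rewrite (eq_bigr (fun i : 'I_N => real_haar p (chain_index i) x)) // IH.
have q0 : 0 < (2 ^+ N)^-1 :> R by rewrite invr_gt0 exprn_gt0.
have qS : (2 ^+ N.+1)^-1 = (2 ^+ N)^-1 / 2 :> R by rewrite exprSr invfM.
(* The interval not yet divided after [N] steps is the support of the next
   Haar function; its left half remains undivided, its right half is the next
   step of the staircase. *)
have -> : chi 0 (2 ^+ N)^-1 x =
    chi 0 (2 ^+ N.+1)^-1 x + chi (2 ^+ N.+1)^-1 (2 ^+ N)^-1 x.
  by apply: chi_split; rewrite qS; lra.
rewrite (exprS t N).
rewrite (eq_bigr
  (fun k : 'I_N => t ^+ k * chi (2 ^+ k.+1)^-1 (2 ^+ k)^-1 x)) //.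
set S := \sum_(k < N) t ^+ k * _; rewrite /=; field; lra.
Qed.

Lemma measurable_chain_sum (R : realType) (p : R) (N : nat) :
  measurable_fun [set: measurableTypeR R]
    (fun x : R => \sum_(i < N) real_haar p (chain_index i) x).
Proof. by apply: measurable_sum => i; exact: measurable_real_haar. Qed.

(** Up to the two indicators in [chain_sumE], each of norm [1 / (t - 1)]
    whatever [N] is, the chain is a multiple of the staircase.  Minkowski's
    inequality, used for the chain and for the staircase, gives both bounds. *)
Lemma chain_sum_near_staircase (R : realType) (F : scalars) (p : R) (N : nat) :
  1 < p ->
  let t := 2 `^ p^-1 in
  let main := (2 - t) / (t - 1) / t * N%:R `^ p^-1 in
  let S := Lp_norm p (\sum_(j <- index_range (@chain_index N)) @haar R F p j) in
  (main%:E <= S + (2 / (t - 1))%:E)%E /\ (S <= (main + 2 / (t - 1))%:E)%E.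
Proof.
move=> p1 t main S; have p0 : 0 < p by lra.
have t1 : 1 < t by rewrite ltr1_powR2 // invr_gt0.
have t2 : t < 2 by exact: powR2_inv_lt2.
have c0 : 0 < (2 - t) / (t - 1) by rewrite divr_gt0 // subr_gt0.
pose f x : R := \sum_(i < N) real_haar p (chain_index i) x.
pose g x :=
  (t - 1)^-1 * chi 0 1 x + - ((t - 1)^-1 * t ^+ N) * chi 0 (2 ^+ N)^-1 x.
pose h x := - ((2 - t) / (t - 1)) * staircase t N x.
have mf : measurable_fun [set: measurableTypeR R] f.
  exact: measurable_chain_sum.
have mg : measurable_fun [set: measurableTypeR R] g.
  by apply: measurable_funD; exact: measurable_scaled_chi.
have mh : measurable_fun [set: measurableTypeR R] h.
  by apply: measurable_funM => //; exact: measurable_staircase.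
have fE : f = fun x => g x + h x by apply/funext => x; exact: chain_sumE.
have SE : S = Lp_norm p f.
  rewrite /S Lp_norm_haar_sum (big_index_range _ (@chain_index_inj N)).
  by rewrite fct_sumE.
have hN : Lp_norm p h = main%:E.
  rewrite Lp_normZ //; last exact: measurable_staircase.
  rewrite Lp_norm_staircase // normrN gtr0_norm // -EFinM; congr (_%:E).
  by rewrite /main mulrA mulrAC.
have d0 : 0 < (t - 1)^-1 by rewrite invr_gt0 subr_gt0.
(* The last indicator has height [t ^ N / (t - 1)], but its support is short
   enough for its norm not to depend on [N]. *)
have tN : t ^+ N * (2 ^+ N)^-1 `^ p^-1 = 1.
  have <- : ((2 ^+ N)^-1) `^ (- p^-1) = t ^+ N by exact: haar_height.
  by rewrite powRN mulVf // gt_eqF // powR_gt0 // invr_gt0 exprn_gt0.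
have q0 : 0 < (2 ^+ N)^-1 :> R by rewrite invr_gt0 exprn_gt0.
have q1 : (2 ^+ N)^-1 <= 1 :> R.
  by rewrite invf_le1 ?exprn_gt0 // exprn_ege1 //; lra.
have gN : (Lp_norm p g <= (2 / (t - 1))%:E)%E.
  apply: (le_trans (Lp_norm_triangle (ltW p1) (measurable_scaled_chi _ _ _)
    (measurable_scaled_chi _ _ _))).
  rewrite !Lp_norm_scaled_chi //.
  rewrite !subr0 powR1 mulr1 normrN normrM (gtr0_norm d0).
  rewrite ger0_norm ?exprn_ge0 ?powR_ge0 //.
  rewrite -mulrA tN -EFinD lee_fin; lra.
rewrite SE -hN; split; last first.
  rewrite EFinD -hN addeC fE.
  apply: (le_trans (Lp_norm_triangle (ltW p1) mg mh)).
  exact: leeD2r.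
have hE : h = fun x => f x + (-1) * g x by apply/funext => x; rewrite fE; ring.
have mg' : measurable_fun [set: measurableTypeR R] (fun x => -1 * g x).
  exact: measurable_funM.
rewrite hE; apply: (le_trans (Lp_norm_triangle (ltW p1) mf mg')).
rewrite Lp_normZ // normrN1 mul1e; exact: leeD2l.
Qed.

(** * The lower bound *)

Theorem proposition1p2 (R : realType) (F : scalars) (p : R) (hp : 1 < p) :
  let p' := p / (p - 1) in
  let pstar := Num.max p p' in
  let psharp := Num.min p p' in
  (disjoint_democracy_constant (@Lp_norm R (scalar_type R F) p)
     (@haar R F p)
   >= ((2 `^ psharp^-1 - 1) / (2 `^ pstar^-1 - 1))%:E)%E.
Proof.
have p0 : 0 < p by exact: lt_trans ltr01 hp.
cbv zeta; set p' := p / (p - 1).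
apply: le_ereal_inf_tmp => -[C| |] [] C1 adm; [|by rewrite leey|by []].
set t := 2 `^ p^-1; pose c := (2 - t) / (t - 1) / t; pose K := 2 / (t - 1).
have t1 : 1 < t by rewrite ltr1_powR2 // invr_gt0.
have t2 : t < 2 by exact: powR2_inv_lt2.
have c0 : 0 < c by rewrite !divr_gt0 // ?subr_gt0; lra.
have tp' : 2 `^ p'^-1 = 2 / t.
  rewrite /p' invf_div mulrBl mulfV ?gt_eqF // mul1r powRB ?powRr1 //.
  by rewrite pnatr_eq0 implybT.
have C0 : 0 <= C by move: C1; rewrite lee_fin; lra.
have cardE N := etrans (card_index_range (@chain_index_inj N))
  (esym (card_index_range (@row_index_inj N))).
have chain_row N := adm _ _ (cardE N) (chain_row_disjoint N).
have row_chain N := adm _ _ (esym (cardE N))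
  (etrans (fdisjoint_sym _ _) (chain_row_disjoint N)).
have cC : c <= C.
  apply: (@unbounded_powR_absorbs R p^-1 c C K); first by rewrite invr_gt0.
  move=> N _; have [lo _] := chain_sum_near_staircase F N hp.
  rewrite -lee_fin EFinD; apply: (le_trans lo).
  rewrite leeD2r // EFinM -(Lp_norm_row F N p0); exact: chain_row.
have Cc : 1 <= C * c.
  apply: (@unbounded_powR_absorbs R p^-1 1 (C * c) (C * K)).
    by rewrite invr_gt0.
  move=> N _; have [_ hi] := chain_sum_near_staircase F N hp.
  rewrite mul1r -lee_fin -(Lp_norm_row F N p0); apply: (le_trans (row_chain N)).
  by rewrite -mulrA -mulrDr EFinM; apply: lee_wpmul2l; rewrite ?lee_fin.
(* The bound is [1 / c] if [p <= p'] and [c] otherwise. *)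
have tE : (2 / t - 1) / (t - 1) = c by rewrite /c; field; lra.
rewrite lee_fin minEle maxEle; case: ifP => _; rewrite tp' -/t.
  rewrite -invf_div tE -[leLHS]mul1r ler_pdivrMr //.
by rewrite tE.
Qed.
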